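(* Let $T$ be a positive theory with the Joint Continuation Property. If all positive formulas $\varphi(x;y)$ with $|y|=1$ are $\mathsf{NIP}$, then $T$ is $\mathsf{NIP}$.
   Context: Positive logic: a positive formula is one built from atomic formulas (including equalities) using $\wedge,\vee,\top,\bot,\exists$. An h-inductive sentence is $\forall x\,(\varphi(x)\to\psi(x))$ with $\varphi,\psi$ positive; a positive theory is a consistent set of h-inductive sentences. A homomorphism is a map preserving positive formulas. $T$ has the Joint Continuation Property if any two models of $T$ admit homomorphisms into a common model of $T$. Formulas $\varphi(x;y)$ are partitioned, with $x,y$ finite tuples of variables, and $|y|$ is the length of $y$. A positive formula $\varphi(x;y)$ has $\mathsf{IP}$ if there are a positive $\psi(x;y)$ with $T\models\forall x,y\,\neg(\varphi(x;y)\wedge\psi(x;y))$, a model $A\models T$, and tuples $(a_i)_{i\in\omega}$, $(b_W)_{W\subseteq\omega}$ from $A$ such that $A\models\varphi(a_i;b_W)$ whenever $i\in W$ and $A\models\psi(a_i;b_W)$ whenever $i\notin W$. Otherwise $\varphi$ is $\mathsf{NIP}$. $T$ is $\mathsf{NIP}$ if every positive formula is. *)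

(* Defs.v *)
From mathcomp Require Import all_boot.
Set Implicit Arguments.
Unset Strict Implicit.
Unset Printing Implicit Defensive.

(* One-sorted first-order signatures; constants are function symbols of
   arity 0. *)
Record language : Type := Language {
  fun_sym : Type;
  fun_arity : fun_sym -> nat;
  rel_sym : Type;
  rel_arity : rel_sym -> nat
}.

Inductive term (L : language) (n : nat) : Type :=
| Var of 'I_n
| App (f : fun_sym L) of ('I_(fun_arity f) -> term L n).

(* Well-scoped syntax: [pform L n] consists of the positive formulas whose free
   variables are among x_0, ..., x_(n-1).  [PEx] binds the variable of index 0
   and shifts the others up by one. *)
Inductive pform (L : language) : nat -> Type :=
| PEq n of term L n & term L n : pform L n
| PRel n (r : rel_sym L) of ('I_(rel_arity r) -> term L n) : pform L n
| PTop n : pform L n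
| PBot n : pform L n
| PAnd n of pform L n & pform L n : pform L n
| POr n of pform L n & pform L n : pform L n
| PEx n of pform L n.+1 : pform L n.

(* As usual in first-order logic, structures are nonempty. *)
Record structure (L : language) : Type := Structure {
  carrier :> Type;
  carrier_inhabited : inhabited carrier;
  fun_interp : forall f : fun_sym L, (fun_arity f).-tuple carrier -> carrier;
  rel_interp : forall r : rel_sym L, (rel_arity r).-tuple carrier -> Prop
}.

Fixpoint eval (L : language) (A : structure L) (n : nat) (v : n.-tuple A)
    (t : term L n) : A :=
  match t with
  | Var i => tnth v i
  | App f args => fun_interp [tuple eval v (args i) | i < fun_arity f]
  end.

Fixpoint sat (L : language) (A : structure L) (n : nat) (phi : pform L n) :
    n.-tuple A -> Prop :=
  match phi in pform _ k return k.-tuple A -> Prop with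
  | PEq _ s t => fun v => eval v s = eval v t
  | PRel _ r args => fun v =>
      rel_interp [tuple eval v (args i) | i < rel_arity r]
  | PTop _ => fun _ => True
  | PBot _ => fun _ => False
  | PAnd _ p q => fun v => sat p v /\ sat q v
  | POr _ p q => fun v => sat p v \/ sat q v
  | PEx _ p => fun v => exists a : A, sat p [tuple of a :: v]
  end.

(* The h-inductive sentence [HInductive phi psi] is
   forall x, (phi(x) -> psi(x)), with x a tuple of [hi_vars] variables. *)
Record h_inductive (L : language) : Type := HInductive {
  hi_vars : nat;
  hi_premise : pform L hi_vars;
  hi_conclusion : pform L hi_vars
}.

Definition h_sat (L : language) (A : structure L) (s : h_inductive L) : Prop :=
  forall v : (hi_vars s).-tuple A, sat (hi_premise s) v -> sat (hi_conclusion s) v.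

Definition h_theory (L : language) : Type := h_inductive L -> Prop.

Definition is_model (L : language) (T : h_theory L) (A : structure L) : Prop :=
  forall s : h_inductive L, T s -> h_sat A s.

Definition consistent (L : language) (T : h_theory L) : Prop :=
  exists A : structure L, is_model T A.

Definition homomorphism (L : language) (A B : structure L) (f : A -> B) : Prop :=
  forall (n : nat) (phi : pform L n) (v : n.-tuple A),
    sat phi v -> sat phi [tuple of map f v].

Definition joint_continuation (L : language) (T : h_theory L) : Prop :=
  forall A B : structure L, is_model T A -> is_model T B ->
  exists C : structure L, is_model T C /\
    (exists f : A -> C, homomorphism f) /\ (exists g : B -> C, homomorphism g).

(* A partitioned formula phi(x; y) with |x| = n and |y| = m is an element of
   [pform L (n + m)]: the first n variables are x, the last m are y. *)
Definition psat (L : language) (A : structure L) (n m : nat)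
    (phi : pform L (n + m)) (a : n.-tuple A) (b : m.-tuple A) : Prop :=
  sat phi [tuple of a ++ b].

Definition contradictory (L : language) (T : h_theory L) (n m : nat)
    (phi psi : pform L (n + m)) : Prop :=
  forall A : structure L, is_model T A ->
  forall (a : n.-tuple A) (b : m.-tuple A), ~ (psat phi a b /\ psat psi a b).

Definition has_IP (L : language) (T : h_theory L) (n m : nat)
    (phi : pform L (n + m)) : Prop :=
  exists psi : pform L (n + m), contradictory T phi psi /\
  exists A : structure L, is_model T A /\
  exists (a : nat -> n.-tuple A) (b : (nat -> Prop) -> m.-tuple A),
    forall (W : nat -> Prop) (i : nat),
      (W i -> psat phi (a i) (b W)) /\ (~ W i -> psat psi (a i) (b W)).

Definition is_NIP (L : language) (T : h_theory L) (n m : nat)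
    (phi : pform L (n + m)) : Prop := ~ has_IP T phi.

Definition theory_NIP (L : language) (T : h_theory L) : Prop :=
  forall (n m : nat) (phi : pform L (n + m)), is_NIP T phi.

(* Main.v *)
Require Import Defs.
From mathcomp Require Import all_boot.
From mathcomp Require Import boolp classical_sets filter.

(** Call a finite family [Phi k] of positive formulas in [x; y] independent when
    arbitrarily long finite sequences of tuples [a_i], taken in models of the
    theory, admit for every choice function [g] some [b] with [Phi (g i) (a_i; b)]
    for all [i].  By compactness, a contradictory pair of formulas that is
    independent is the same thing as a formula with IP, and so the question is
    about independent pairs.

    The key fact ([independent_absorb], [independent_realised]) replaces the usual
    argument with indiscernible sequences: if no contradictory pair with right
    variables [y] is independent, then the members of any independent family can
    be realised simultaneously by one point [(a; b)].  To see why, cut a long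
    sequence into blocks and compare, on a block, the conjunction of [Phi (g i)]
    along a pattern [g] with the conjunction of [Phi k0] along the constant
    pattern.  These two formulas on blocks again form an independent pair, so
    they cannot be contradictory, and in some model some [b] realises both over
    the same block.  The two formulas may be strengthened by any positive property
    that all blocks share, in particular by being still shattered by [Phi] and
    already realising other combined patterns.  Treating the finitely many
    patterns [g] one at a time therefore keeps the family independent while
    [Phi k0] is added to each member, and after a round for each [k0] one point
    realises everything.  Only positive formulas are ever used, since their
    contradictoriness is tested against the theory and not through negation.

    NIP then passes from right variables [y] and [z] to [y, z] ([NIP_in_sum]).  If
    [P(x; y, z)] and [Q(x; y, z)] form an independent contradictory pair, consider,
    on blocks of length [N], the formulas in [y] saying that some [z] realises a
    given pattern of [P] and [Q] on the block.  As the pattern varies in [2^N],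
    they form an independent family.  A common realisation is a block together
    with a single [y] over which all [2^N] patterns are realised by a suitable
    [z], so that the pair is independent in [z], with [y] moved to the left.

    Independence speaks of finite sequences, whereas IP asks for an infinite one
    and all subsets of it.  An ultraproduct over the natural numbers passes from
    the former to the latter ([independent_compact]). *)

Set Implicit Arguments.
Unset Strict Implicit.
Unset Printing Implicit Defensive.
Local Open Scope classical_set_scope.

(** * Substitution of variables *)

Fixpoint rename_term (L : language) (k l : nat) (f : 'I_k -> 'I_l)
    (t : term L k) : term L l :=
  match t with
  | Var i => Var L (f i)
  | App s args => App (fun i => rename_term f (args i))
  end.

Definition rename_lift (k l : nat) (f : 'I_k -> 'I_l) (i : 'I_k.+1) : 'I_l.+1 :=
  if unlift ord0 i is Some j then lift ord0 (f j) else ord0.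

Fixpoint rename_pform (L : language) (k : nat) (phi : pform L k) :
    forall l, ('I_k -> 'I_l) -> pform L l :=
  match phi in pform _ k return forall l, ('I_k -> 'I_l) -> pform L l with
  | PEq _ s t => fun l f => PEq (rename_term f s) (rename_term f t)
  | PRel _ r args => fun l f => PRel (fun i => rename_term f (args i))
  | PTop _ => fun l f => PTop L l
  | PBot _ => fun l f => PBot L l
  | PAnd _ p q => fun l f => PAnd (rename_pform p f) (rename_pform q f)
  | POr _ p q => fun l f => POr (rename_pform p f) (rename_pform q f)
  | PEx _ p => fun l f => PEx (rename_pform p (rename_lift f))
  end.

Lemma eval_rename (L : language) (A : structure L) (k l : nat)
    (f : 'I_k -> 'I_l) (t : term L k) (v : l.-tuple A) :
  eval v (rename_term f t) = eval [tuple tnth v (f i) | i < k] t.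
Proof.
elim: t => [i|s args IH] /=; first by rewrite tnth_mktuple.
by congr fun_interp; apply: eq_mktuple.
Qed.

Lemma cons_mktuple (X : Type) (k : nat) (x : X) (f : 'I_k -> X) :
  [tuple of x :: [tuple f i | i < k]] =
  [tuple if unlift ord0 i is Some j then f j else x | i < k.+1].
Proof.
apply: eq_from_tnth => i; rewrite tnth_mktuple.
case: unliftP => [j ->|->]; last exact: tnth0.
by rewrite tnthS tnth_mktuple.
Qed.

Lemma sat_rename (L : language) (A : structure L) (k : nat) (phi : pform L k) :
  forall (l : nat) (f : 'I_k -> 'I_l) (v : l.-tuple A),
  sat (rename_pform phi f) v <-> sat phi [tuple tnth v (f i) | i < k].
Proof.
elim: phi => {k} [k s t|k r args|k|k|k p IHp q IHq|k p IHp q IHq|k p IHp] l f v //=.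
- by rewrite !eval_rename.
- have -> // : [tuple eval v (rename_term f (args i)) | i < rel_arity r] =
    [tuple eval [tuple tnth v (f j) | j < k] (args i) | i < rel_arity r].
  by apply: eq_mktuple => i; exact: eval_rename.
- by rewrite IHp IHq.
- by rewrite IHp IHq.
- have E a : [tuple tnth [tuple of a :: v] (rename_lift f i) | i < k.+1] =
    [tuple of a :: [tuple tnth v (f i) | i < k]].
    rewrite cons_mktuple; apply: eq_mktuple => i; rewrite /rename_lift.
    by case: unliftP => [j _|_]; rewrite ?tnthS ?tnth0.
  by split=> -[a Ha]; exists a; move: Ha; rewrite IHp E.
Qed.

Fixpoint pexists (L : language) (m k : nat) : pform L (m + k) -> pform L k :=
  match m return pform L (m + k) -> pform L k with
  | 0 => fun p => p
  | m'.+1 => fun p => pexists (PEx p)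
  end.

Lemma sat_pexists (L : language) (A : structure L) (m k : nat)
    (p : pform L (m + k)) (v : k.-tuple A) :
  sat (pexists p) v <-> exists u : m.-tuple A, sat p [tuple of u ++ v].
Proof.
elim: m p => [|m IH] p /=.
  have E (u : 0.-tuple A) : [tuple of u ++ v] = v by apply: val_inj; rewrite (tuple0 u).
  by split=> [H|[u]]; [exists [tuple]; rewrite E|rewrite E].
rewrite IH /=; split=> [[u [a H]]|[u H]].
  exists [tuple of a :: u].
  by have -> : [tuple of [tuple of a :: u] ++ v] = [tuple of a :: [tuple of u ++ v]]
    by exact: val_inj.
exists [tuple of behead u], (thead u).
by have -> : [tuple of thead u :: [tuple of [tuple of behead u] ++ v]] =
  [tuple of u ++ v] by apply: val_inj => /=; case/tupleP: u H.
Qed.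

(** * Positively definable relations *)

(** Working with relations defined by positive formulas, rather than with the
    formulas, lets the variables be indexed by arbitrary types, so that blocks of
    tuples and added parameters are products and sums of index types. *)
Definition relation (L : language) (V : Type) : Type :=
  forall A : structure L, (V -> A) -> Prop.

(** The listing [f] of variables need be neither injective nor surjective, which
    makes closure under [positive_rename] immediate. *)
Definition positive (L : language) (V : Type) (R : relation L V) : Prop :=
  exists (k : nat) (f : 'I_k -> V) (phi : pform L k),
  forall A v, R A v <-> sat phi [tuple v (f i) | i < k].

(** Any numbering of the variables, injective or not, is good enough to recover a
    formula, because the valuation is read through the numbering. *)
Lemma positiveE (L : language) (V : Type) (R : relation L V) (k : nat)
    (e : V -> 'I_k) :
  positive R -> exists phi : pform L k,
  forall (A : structure L) (v : k.-tuple A), sat phi v <-> R A (fun x => tnth v (e x)).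
Proof.
move=> [l [f [phi H]]]; exists (rename_pform phi (e \o f)) => A v.
by rewrite H sat_rename.
Qed.

Lemma positive_ext (L : language) (V : Type) (R S : relation L V) :
  (forall A v, R A v <-> S A v) -> positive R -> positive S.
Proof.
by move=> RS [l [f [phi H]]]; exists l, f, phi => A v; rewrite -RS.
Qed.

Lemma positive_rename (L : language) (V W : Type) (f : V -> W) (R : relation L V) :
  positive R -> positive (fun A w => R A (w \o f)).
Proof. by move=> [l [g [phi H]]]; exists l, (f \o g), phi => A v; rewrite H. Qed.

Lemma positive_enum (L : language) (V : finType) (R : relation L V) :
  positive R -> exists phi : pform L #|V|,
  forall A v, R A v <-> sat phi [tuple v (enum_val i) | i < #|V|].
Proof.
move=> /(positiveE (@enum_rank V)) [phi H]; exists phi => A v; rewrite H.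
suff -> : (fun x => tnth [tuple v (enum_val i) | i < #|V|] (enum_rank x)) = v by [].
by apply: funext => x; rewrite tnth_mktuple enum_rankK.
Qed.

Lemma positive_true (L : language) (V : Type) :
  positive (fun (A : structure L) (v : V -> A) => True).
Proof. by exists 0, (fun i : 'I_0 => match notF (ltn_ord i) with end), (PTop L 0). Qed.

Lemma positive_and (L : language) (V : finType) (R S : relation L V) :
  positive R -> positive S -> positive (fun A v => R A v /\ S A v).
Proof.
move=> /positive_enum [p Hp] /positive_enum [q Hq].
by exists #|V|, (@enum_val V V), (PAnd p q) => A v; rewrite Hp Hq.
Qed.

Lemma positive_imp (L : language) (V : Type) (c : bool) (R : relation L V) :
  positive R -> positive (fun A v => c -> R A v).
Proof.
case: c => H; first by apply: positive_ext H => A v; split=> [|H]; last exact: H.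
by apply: positive_ext (positive_true L V).
Qed.

Lemma positive_all (L : language) (V K : finType) (R : K -> relation L V) :
  (forall k, positive (R k)) -> positive (fun A v => forall k, R k A v).
Proof.
move=> HR.
suff H (s : seq K) : positive (fun A v => forall k, k \in s -> R k A v).
  by apply: positive_ext (H (enum K)) => A v; split=> H' k *; apply: H'; rewrite ?mem_enum.
elim: s => [|k s IH]; first by apply: positive_ext (positive_true L V).
apply: positive_ext (positive_and (HR k) IH) => A v; split=> [[H1 H2] l|H].
  by rewrite inE => /orP[/eqP ->|/H2].
by split=> [|l ls]; apply: H; rewrite inE ?eqxx ?ls ?orbT.
Qed.

Definition glue (X V U : Type) (a : V -> X) (b : U -> X) (w : V + U) : X :=
  match w with inl v => a v | inr u => b u end.

Lemma glueK (X V U : Type) (w : V + U -> X) : glue (w \o inl) (w \o inr) = w.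
Proof. by apply: funext => -[]. Qed.

Lemma positive_ex (L : language) (V U : finType) (R : relation L (V + U)) :
  positive R -> positive (fun A v => exists u : U -> A, R A (glue v u)).
Proof.
pose e (w : V + U) : 'I_(#|U| + #|V|) :=
  match w with inl v => rshift #|U| (enum_rank v) | inr u => lshift #|V| (enum_rank u) end.
move=> /(positiveE e) [p Hp].
exists #|V|, (@enum_val V V), (pexists p) => A v; rewrite sat_pexists.
have E (u : #|U|.-tuple A) :
    (fun x => tnth [tuple of u ++ [tuple v (enum_val i) | i < #|V|]] (e x)) =
    glue v (fun x => tnth u (enum_rank x)).
  by apply: funext => -[x|x] /=; rewrite ?tnth_rshift ?tnth_lshift // tnth_mktuple enum_rankK.
split=> [[u Hu]|[u]]; last by rewrite Hp E => Hu; eexists; exact: Hu.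
exists [tuple u (enum_val i) | i < #|U|]; rewrite Hp E.
suff -> : (fun x => tnth [tuple u (enum_val i) | i < #|U|] (enum_rank x)) = u by [].
by apply: funext => x; rewrite tnth_mktuple enum_rankK.
Qed.

(** * Independent families of formulas *)

(** Finite sequences are indexed by finite types instead of lengths: a sequence of
    blocks is then a sequence over a product type, without index arithmetic. *)
Definition independent (L : language) (T : h_theory L) (V U : Type) (K : finType)
    (Phi : K -> relation L (V + U)) : Prop :=
  forall I : finType, exists A : structure L, is_model T A /\
  exists a : I -> V -> A, forall g : {ffun I -> K}, exists b : U -> A,
  forall i, Phi (g i) A (glue (a i) b).

Definition incompatible (L : language) (T : h_theory L) (V : Type)
    (P Q : relation L V) : Prop :=
  forall A, is_model T A -> forall v, ~ (P A v /\ Q A v).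

Definition pair_family (L : language) (V : Type) (P Q : relation L V) (c : bool) :
    relation L V := if c then P else Q.
Arguments pair_family {L V} P Q c A _.

(** NIP for all positive formulas with right variables [U], in a form that speaks
    only of finite sequences. *)
Definition NIP_in (L : language) (T : h_theory L) (U : Type) : Prop :=
  forall (V : finType) (P Q : relation L (V + U)), positive P -> positive Q ->
  incompatible T P Q -> ~ independent T (pair_family P Q).

(** Substitutes for [x] the [i]-th of a block of [I] tuples of variables. *)
Definition block (I V U : Type) (i : I) (w : V + U) : I * V + U :=
  match w with inl v => inl (i, v) | inr u => inr u end.

Lemma glue_block (X I V U : Type) (i : I) (a : I * V -> X) (b : U -> X) :
  glue a b \o block i = glue (fun v => a (i, v)) b.
Proof. by apply: funext => -[]. Qed.

(** Realising a pattern on a block is a positive property of the block, so it may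
    be carried along inside formulas. *)
Lemma positive_realised (L : language) (V U I : finType)
    (Phi : I -> relation L (V + U)) :
  (forall i, positive (Phi i)) ->
  positive (fun (A : structure L) (x : I * V -> A) =>
    exists b, forall i, Phi i A (glue (fun v => x (i, v)) b)).
Proof.
move=> HPhi; have := positive_ex (positive_all (fun i => positive_rename (block i) (HPhi i))).
by apply: positive_ext => A x; split=> -[b Hb]; exists b => i; move: (Hb i); rewrite glue_block.
Qed.

(** The induction runs over the list [s] of patterns [g] for which [Phi (g i)] and
    [Phi k0] have already been realised together on every block.  The induction
    statement must provide any number [J] of such blocks, shattered jointly by
    [Phi]: the induction step uses up the case of [N * J] blocks, seen as [N]
    blocks of blocks, to obtain the case of [J] blocks for one more pattern. *)
Lemma independent_absorb (L : language) (T : h_theory L) (V U K : finType)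
    (Phi : K -> relation L (V + U)) (k0 : K) :
  NIP_in T U -> (forall k, positive (Phi k)) -> independent T Phi ->
  independent T (fun k A w => Phi k A w /\ Phi k0 A w).
Proof.
move=> nip posPhi indPhi I.
pose good (J : finType) (s : seq {ffun I -> K}) : relation L (J * I * V) := fun A x =>
  (forall j (g : {ffun I -> K}), g \in s -> exists b, forall i,
     Phi (g i) A (glue (fun v => x (j, i, v)) b) /\
     Phi k0 A (glue (fun v => x (j, i, v)) b)) /\
  (forall h : {ffun J * I -> K}, exists b, forall p,
     Phi (h p) A (glue (fun v => x (p, v)) b)).
suff H s (J : finType) : exists A, is_model T A /\ exists x, good J s A x.
  (* One block with all patterns in [s] is what has to be found. *)
  have [A [mA [x [Hx _]]]] := H (enum {ffun I -> K}) unit.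
  exists A; split=> //; exists (fun i v => x (tt, i, v)) => g.
  by apply: Hx; rewrite mem_enum.
elim: s J => [|g s IH] J.
  have [A [mA [a Ha]]] := indPhi (J * I)%type.
  by exists A; split=> //; exists (fun p => a p.1 p.2); split.
have pos_good : positive (good J s).
  apply: positive_and.
    apply: positive_all => j.
    exact: (positive_all (fun h : {ffun I -> K} => positive_imp (h \in s)
      (positive_rename (fun q => (j, q.1, q.2))
        (positive_realised (fun i => positive_and (posPhi (h i)) (posPhi k0)))))).
  exact: (positive_all (fun h : {ffun J * I -> K} =>
    positive_realised (fun p => posPhi (h p)))).
(* [extend f] is the formula on [J] blocks that repeats the pattern [f] in each
   block.  It includes [good J s], so that a common realisation of [extend g] and
   of the constant pattern has everything obtained before. *)
pose extend (f : I -> K) : relation L (J * I * V + U) := fun A w =>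
  good J s A (w \o inl) /\ forall p, Phi (f p.2) A (w \o block p).
have pos_extend f : positive (extend f).
  apply: positive_and; first exact: positive_rename.
  by apply: positive_all => p; exact: positive_rename.
have [[A [mA [x [Hg Hk]]]]|none] := pselect (exists A, is_model T A /\
    exists w, extend g A w /\ extend (fun=> k0) A w).
  exists A; split=> //; exists (x \o inl); case: Hg => -[Hs Hh] Hg; split=> // j f.
  rewrite inE => /orP[/eqP ->|]; last exact: Hs.
  exists (x \o inr) => i; split; first by move: (Hg (j, i)); rewrite -{1}(glueK x) glue_block.
  by case: Hk => _ /(_ (j, i)); rewrite -{1}(glueK x) glue_block.
(* If the two formulas were contradictory, they would be an independent pair: a
   choice between them on [N] groups of [J] blocks is one pattern on all the
   blocks, which is realised as these are shattered by [Phi]. *)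
case: (nip _ _ _ (pos_extend g) (pos_extend (fun=> k0))).
  by move=> A mA w Hw; apply: none; exists A; split=> //; exists w.
move=> N; have [A [mA [x [Hs Hh]]]] := IH (N * J)%type.
exists A; split=> //; exists (fun n q => x (n, q.1.1, q.1.2, q.2)) => c.
have [b Hb] := Hh [ffun q => if c q.1.1 then g q.2 else k0].
exists b => n.
have Hgood : good J s A (fun q => x (n, q.1.1, q.1.2, q.2)).
  split=> [j f fs|h]; first exact: (Hs (n, j) f fs).
  have [b' Hb'] := Hh [ffun q => h (q.1.2, q.2)].
  by exists b' => -[j i]; move: (Hb' (n, j, i)); rewrite ffunE.
by rewrite /pair_family; case E: (c n); split=> // -[j i]; rewrite glue_block;
  move: (Hb (n, j, i)); rewrite ffunE /= E.
Qed.

(** Absorb the members of the family one after the other. *)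
Lemma independent_realised (L : language) (T : h_theory L) (V U K : finType)
    (Phi : K -> relation L (V + U)) :
  NIP_in T U -> (forall k, positive (Phi k)) -> independent T Phi ->
  exists A, is_model T A /\ exists w, forall k, Phi k A w.
Proof.
move=> nip posPhi indPhi.
suff H (s : seq K) : let Psi k : relation L (V + U) := fun A w =>
    Phi k A w /\ forall l, l \in s -> Phi l A w in
    (forall k, positive (Psi k)) /\ independent T Psi.
  have [_ /(_ unit) [A [mA [a Ha]]]] := H (enum K); exists A; split=> //.
  (* For an empty [K] any valuation does; otherwise a sequence of length one does. *)
  have [k0|K0] := pickP (fun k : K => true); last first.
    have [x] := carrier_inhabited A; exists (fun=> x) => k.
    by have := K0 k.
  have [b /(_ tt) [_ Hb]] := Ha [ffun=> k0].
  by exists (glue (a tt) b) => k; apply: Hb; rewrite mem_enum.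
elim: s => [|l s [IHp IHi]] Psi.
  split=> [k|I]; first by apply: positive_ext (posPhi k) => A w; split=> // -[].
  have [A [mA [a Ha]]] := indPhi I; exists A; split=> //; exists a => g.
  by have [b Hb] := Ha g; exists b.
have posPsi k : positive (Psi k).
  apply: positive_and => //; apply: positive_all => j; exact: positive_imp.
split=> // I; have [A [mA [a Ha]]] := independent_absorb l nip IHp IHi I.
exists A; split=> //; exists a => g; have [b Hb] := Ha g; exists b => i.
have [[Hk Hs] [Hl _]] := Hb i; split=> // j.
by rewrite inE => /orP[/eqP ->|/Hs].
Qed.

(** [Theta eta] says that some [z] realises the pattern [eta] of [P] and [Q] on a
    block of [I] tuples.  A pattern of patterns on [J] blocks is a pattern on
    [J * I] tuples, whence the independence of [Theta]. *)
Lemma NIP_in_sum (L : language) (T : h_theory L) (Y Z : finType) :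
  NIP_in T Y -> NIP_in T Z -> NIP_in T (Y + Z)%type.
Proof.
move=> nipY nipZ V P Q posP posQ incPQ ind.
pose assoc (w : V + (Y + Z)) : (V + Y) + Z :=
  match w with inl v => inl (inl v) | inr (inl y) => inl (inr y) | inr (inr z) => inr z end.
apply: (nipZ _ _ _ (positive_rename assoc posP) (positive_rename assoc posQ)).
  by move=> A mA w; exact: incPQ.
move=> I.
pose Theta (eta : {ffun I -> bool}) : relation L (I * V + Y) := fun A w =>
  exists z : Z -> A, forall i,
    pair_family P Q (eta i) A (glue (w \o block i) z \o assoc).
have posTheta eta : positive (Theta eta).
  pose shift (i : I) (w : (V + Y) + Z) : (I * V + Y) + Z :=
    match w with inl x => inl (block i x) | inr z => inr z end.
  have := @positive_ex L _ _ _ (@positive_all L _ _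
    (fun i A w => pair_family P Q (eta i) A (w \o (shift i \o assoc))) _).
  move=> H; apply: (positive_ext _ (H _)) => [A w|i]; last first.
    by apply: positive_rename; case: (eta i).
  split=> -[z Hz]; exists z => i; move: (Hz i);
  suff -> : glue w z \o (shift i \o assoc) = glue (w \o block i) z \o assoc by [];
  by apply: funext => -[v|[y|z']].
have indTheta : independent T Theta.
  move=> J; have [A [mA [a Ha]]] := ind (J * I)%type.
  exists A; split=> //; exists (fun j q => a (j, q.1) q.2) => g.
  have [b Hb] := Ha [ffun q => g q.1 q.2].
  exists (b \o inl) => j; exists (b \o inr) => i; move: (Hb (j, i)); rewrite ffunE /=.
  suff -> : glue (glue (fun q => a (j, q.1) q.2) (b \o inl) \o block i) (b \o inr) \o assoc =
    glue (a (j, i)) b by [].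
  by apply: funext => -[v|[y|z]].
have [A [mA [w Hw]]] := independent_realised nipY posTheta indTheta.
exists A; split=> //; exists (fun i => w \o block i) => eta.
by have [z Hz] := Hw eta; exists z => i; move: (Hz i); rewrite /pair_family; case: (eta i).
Qed.

(** * Ultraproducts and compactness *)

Lemma choice_dep (I : Type) (B : I -> Type) (P : forall i, B i -> Prop) :
  (forall i, exists x, P i x) -> exists f : forall i, B i, forall i, P i (f i).
Proof. by move=> H; exists (fun i => projT1 (cid (H i))) => i; case: cid. Qed.

Lemma structure_point (L : language) (A : structure L) : {x : A | True}.
Proof. by apply: cid; have [x] := carrier_inhabited A; exists x. Qed.

Definition agree (L : language) (A : nat -> structure L) (F : set_system nat)
    (f g : forall n, A n) : Prop := F [set n | f n = g n].

Definition ultracarrier (L : language) (A : nat -> structure L) (F : set_system nat) :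
    Type := {C : (forall n, A n) -> Prop | exists f, C = agree F f}.

Definition germ (L : language) (A : nat -> structure L) (F : set_system nat)
    (f : forall n, A n) : ultracarrier A F :=
  exist _ (agree F f) (ex_intro _ f erefl).

Definition repr (L : language) (A : nat -> structure L) (F : set_system nat)
    (c : ultracarrier A F) : forall n, A n := projT1 (cid (proj2_sig c)).

Lemma reprK (L : language) (A : nat -> structure L) (F : set_system nat)
    (c : ultracarrier A F) : germ F (repr c) = c.
Proof.
case: c => C HC; apply: eq_exist => /=.
by rewrite /repr; case: cid.
Qed.

Lemma germ_eq (L : language) (A : nat -> structure L) (F : set_system nat)
    (FF : Filter F) (f g : forall n, A n) : germ F f = germ F g <-> agree F f g.
Proof.
split=> [[E]|fg].
  have : agree F g g by apply: filterS filterT => n.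
  by rewrite -E.
apply: eq_exist; apply: funext => h; apply: propext; split=> H.
  by apply: filterS2 fg H => n /= <-.
by apply: filterS2 fg H => n /= ->.
Qed.

(** The carrier consists of equivalence classes, so that equality in the structure
    is agreement on a set of the filter. *)
Definition ultraproduct (L : language) (A : nat -> structure L) (F : set_system nat) :
    structure L :=
  @Structure L (ultracarrier A F)
    (inhabits (germ F (fun n => projT1 (structure_point (A n)))))
    (fun s t => germ F (fun n =>
       fun_interp [tuple repr (tnth t i) n | i < fun_arity s]))
    (fun r t => F [set n | rel_interp [tuple repr (tnth t i) n | i < rel_arity r]]).

Lemma repr_germ (L : language) (A : nat -> structure L) (F : set_system nat)
    (FF : Filter F) (f : forall n, A n) : agree F (repr (germ F f)) f.
Proof. by apply/germ_eq; rewrite reprK. Qed.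

Lemma agree_tuple (L : language) (A : nat -> structure L) (F : set_system nat)
    (FF : Filter F) (k : nat) (f g : 'I_k -> forall n, A n) :
  (forall i, agree F (f i) (g i)) ->
  F [set n | [tuple f i n | i < k] = [tuple g i n | i < k]].
Proof.
move=> fg; have : F [set n | forall i, f i n = g i n] by exact: filter_forall.
by apply: filterS => n H; exact: eq_mktuple.
Qed.

Lemma eval_ultraproduct (L : language) (A : nat -> structure L) (F : set_system nat)
    (FF : Filter F) (k : nat) (f : 'I_k -> forall n, A n) (t : term L k) :
  eval (A := ultraproduct A F) [tuple germ F (f i) | i < k] t =
  germ F (fun n => eval [tuple f i n | i < k] t).
Proof.
elim: t => [i|s args IH] /=.
  rewrite tnth_mktuple; congr (germ F _).
  by apply: functional_extensionality_dep => n; rewrite tnth_mktuple.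
apply/germ_eq; pose g j n := eval [tuple f i n | i < k] (args j).
have := agree_tuple FF (fun j => repr_germ FF (g j)).
apply: filterS => n /= <-; congr fun_interp; apply: eq_mktuple => j.
by rewrite tnth_mktuple IH.
Qed.

(** Łoś's theorem for positive formulas.  The ultrafilter property is used for
    disjunctions, and choice for the existential quantifier.  As it is an
    equivalence, h-inductive sentences are preserved ([model_ultraproduct]). *)
Lemma sat_ultraproduct (L : language) (A : nat -> structure L) (F : set_system nat)
    (UF : UltraFilter F) (k : nat) (phi : pform L k) : forall f : 'I_k -> forall n, A n,
  sat (A := ultraproduct A F) phi [tuple germ F (f i) | i < k] <->
  F [set n | sat phi [tuple f i n | i < k]].
Proof.
have FF : Filter F by exact: _.
elim: phi => {k} [k s t|k r args|k|k|k p IHp q IHq|k p IHp q IHq|k p IHp] f /=.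
- by rewrite !eval_ultraproduct germ_eq.
- pose g j n := eval [tuple f i n | i < k] (args j).
  have -> : [tuple eval (A := ultraproduct A F) [tuple germ F (f i) | i < k] (args j)
      | j < rel_arity r] = [tuple germ F (g j) | j < rel_arity r].
    by apply: eq_mktuple => j; rewrite eval_ultraproduct.
  have E n : [tuple repr (tnth [tuple germ F (g j) | j < rel_arity r] j) n
      | j < rel_arity r] = [tuple repr (germ F (g j)) n | j < rel_arity r].
    by apply: eq_mktuple => j; rewrite tnth_mktuple.
  have := agree_tuple FF (fun j => repr_germ FF (g j)).
  by move=> H; split; apply: filterS2 H => n /=; rewrite E => ->.
- by split=> // _; apply: filterS filterT.
- by split=> // H; case: (filter_ex H).
- rewrite IHp IHq; split=> [[Hp Hq]|H]; first exact: filterI.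
  by split; apply: filterS H => n [].
- rewrite IHp IHq; split=> [[|]|H].
  + by apply: filterS => n; left.
  + by apply: filterS => n; right.
  have [Hp|Hp] := in_ultra_setVsetC [set n | sat p [tuple f i n | i < k]] UF; first by left.
  by right; apply: filterS2 H Hp => n /= [Hn Nn|//]; case: (Nn Hn).
have consE g n : [tuple of g n :: [tuple f i n | i < k]] =
    [tuple (if unlift ord0 i is Some j then f j else g) n | i < k.+1].
  by rewrite cons_mktuple; apply: eq_mktuple => i; case: (unlift ord0 i).
have consU g : [tuple of (germ F g : ultraproduct A F) :: [tuple germ F (f i) | i < k]] =
    [tuple germ F (if unlift ord0 i is Some j then f j else g) | i < k.+1].
  by rewrite cons_mktuple; apply: eq_mktuple => i; case: (unlift ord0 i).
split=> [[c]|H].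
  rewrite -(reprK c) consU IHp; apply: filterS => n Hn.
  by exists (repr c n); rewrite consE.
have /choice_dep [g Hg] : forall n, exists x : A n,
    (exists y, sat p [tuple of y :: [tuple f i n | i < k]]) ->
    sat p [tuple of x :: [tuple f i n | i < k]].
  move=> n; have [[y Hy]|N] := pselect (exists y, sat p [tuple of y :: [tuple f i n | i < k]]).
    by exists y.
  by exists (projT1 (structure_point (A n))) => /N.
exists (germ F g); rewrite consU IHp; apply: filterS H => n /= Hn.
by rewrite -consE; exact: Hg.
Qed.

Lemma positive_ultraproduct (L : language) (A : nat -> structure L) (F : set_system nat)
    (UF : UltraFilter F) (V : Type) (R : relation L V) (f : V -> forall n, A n) :
  positive R ->
  R (ultraproduct A F) (fun x => germ F (f x)) <-> F [set n | R (A n) (fun x => f x n)].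
Proof.
move=> [k [e [phi H]]]; rewrite H sat_ultraproduct.
by split; apply: filterS => n /=; rewrite H.
Qed.

Lemma model_ultraproduct (L : language) (T : h_theory L) (A : nat -> structure L)
    (F : set_system nat) (UF : UltraFilter F) :
  (forall n, is_model T (A n)) -> is_model T (ultraproduct A F).
Proof.
move=> mA s Ts v.
have -> : v = [tuple germ F (repr (tnth v i)) | i < hi_vars s].
  by apply: eq_from_tnth => i; rewrite tnth_mktuple reprK.
rewrite !sat_ultraproduct; apply: filterS => n; exact: mA.
Qed.

(** The [n]-th model carries a shattered sequence of length [n]; in the ultraproduct
    the [i]-th term is given by the models with [i < n], and [W] is represented by
    its traces on the sets of numbers below [n]. *)
Lemma independent_compact (L : language) (T : h_theory L) (V U : Type)
    (P Q : relation L (V + U)) :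
  positive P -> positive Q -> independent T (pair_family P Q) ->
  exists A, is_model T A /\
  exists (a : nat -> V -> A) (b : (nat -> Prop) -> U -> A), forall W i,
    (W i -> P A (glue (a i) (b W))) /\ (~ W i -> Q A (glue (a i) (b W))).
Proof.
move=> posP posQ ind.
have [F [UF oF]] := ultraFilterLemma eventually_filter.
have /choice [A HA] : forall n, exists A, is_model T A /\
    exists (a : 'I_n -> V -> A) (b : {ffun 'I_n -> bool} -> U -> A),
    forall (g : {ffun 'I_n -> bool}) i, pair_family P Q (g i) A (glue (a i) (b g)).
  move=> n; have [A [mA [a Ha]]] := ind 'I_n; have [b Hb] := choice Ha.
  by exists A; split=> //; exists a, b.
have mA n : is_model T (A n) by case: (HA n).
have {HA} /choice_dep [a Ha] : forall n,
    exists a : 'I_n -> V -> A n, exists b : {ffun 'I_n -> bool} -> U -> A n,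
    forall (g : {ffun 'I_n -> bool}) i,
    pair_family P Q (g i) (A n) (glue (a i) (b g)) by move=> n; case: (HA n).
have {Ha} /choice_dep [b Hb] := Ha.
(* The default value occurs only in the finitely many models with [n <= i]. *)
pose a' i (v : V) n := if insub i is Some j then a n j v else projT1 (structure_point (A n)).
pose b' W (u : U) n := b n [ffun j : 'I_n => `[< W (val j) >]] u.
exists (ultraproduct A F); split; first exact: model_ultraproduct.
exists (fun i v => germ F (a' i v)), (fun W u => germ F (b' W u)) => W i.
have H R : positive R -> (forall n (lt_in : i < n), R (A n) (glue (a n (Ordinal lt_in))
     (b n [ffun j : 'I_n => `[< W (val j) >]]))) ->
   R (ultraproduct A F) (glue (fun v => germ F (a' i v)) (fun u => germ F (b' W u))).
  move=> posR HR.
  have -> : glue (fun v => germ F (a' i v)) (fun u => germ F (b' W u)) =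
    fun x : V + U => germ F (glue (a' i) (b' W) x) by apply: funext => -[].
  rewrite positive_ultraproduct //; apply: oF; exists i.+1 => // n /= lt_in.
  have := HR n lt_in; congr (R _ _); apply: funext => -[v|u] //=.
  by rewrite /a' insubT.
split=> HW; apply: H => // n lt_in;
  have := Hb n [ffun j : 'I_n => `[< W (val j) >]] (Ordinal lt_in);
  rewrite /pair_family ffunE /=; first by rewrite asboolT.
by rewrite asboolF.
Qed.

(** * One parameter suffices *)

Lemma tuple_glue (X : Type) (n m : nat) (a : n.-tuple X) (b : m.-tuple X) :
  [tuple glue (tnth a) (tnth b) (split i) | i < n + m] = [tuple of a ++ b].
Proof.
apply: eq_from_tnth => i; rewrite tnth_mktuple.
rewrite -[in RHS](splitK i).
by case: (split i) => j; rewrite ?tnth_lshift ?tnth_rshift.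
Qed.

Lemma NIP_in_one (L : language) (T : h_theory L) :
  (forall (n : nat) (phi : pform L (n + 1)), is_NIP T phi) -> NIP_in T 'I_1.
Proof.
move=> h1 V P Q posP posQ incPQ ind.
pose e (w : V + 'I_1) : 'I_(#|V| + 1) :=
  match w with inl v => lshift 1 (enum_rank v) | inr u => rshift #|V| u end.
have [p Hp] := positiveE e posP; have [q Hq] := positiveE e posQ.
apply: (h1 #|V| p); exists q; split.
  by move=> A mA a b; rewrite /psat Hp Hq; exact: incPQ.
have [A [mA [a [b Hab]]]] := independent_compact posP posQ ind.
exists A; split=> //.
exists (fun i => [tuple a i (enum_val j) | j < #|V|]).
exists (fun W => [tuple b W j | j < 1]) => W i.
rewrite /psat Hp Hq.
suff -> : (fun x => tnth [tuple of [tuple a i (enum_val j) | j < #|V|] ++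
    [tuple b W j | j < 1]] (e x)) = glue (a i) (b W) by [].
by apply: funext => -[v|u] /=; rewrite ?tnth_lshift ?tnth_rshift tnth_mktuple ?enum_rankK.
Qed.

Lemma NIP_in_retract (L : language) (T : h_theory L) (U U' : Type)
    (e : U -> U') (d : U' -> U) : cancel e d -> NIP_in T U' -> NIP_in T U.
Proof.
move=> eK nip V P Q posP posQ incPQ ind.
pose f (w : V + U) : V + U' := match w with inl v => inl v | inr u => inr (e u) end.
apply: (nip _ _ _ (positive_rename f posP) (positive_rename f posQ)).
  by move=> A mA w; exact: incPQ.
move=> I; have [A [mA [a Ha]]] := ind I; exists A; split=> //; exists a => g.
have [b Hb] := Ha g; exists (b \o d) => i.
have E : glue (a i) (b \o d) \o f = glue (a i) b by apply: funext => -[v|u] //=; rewrite eK.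
by move: (Hb i); rewrite -E /pair_family; case: (g i).
Qed.

(** Without right variables the two formulas of a pair would have to hold at the
    same point. *)
Lemma NIP_in_empty (L : language) (T : h_theory L) : NIP_in T 'I_0.
Proof.
move=> V P Q _ _ incPQ ind; have [A [mA [a Ha]]] := ind unit.
have [b Hb] := Ha [ffun=> true]; have [c Hc] := Ha [ffun=> false].
have E : b = c by apply: funext => -[].
apply: (incPQ A mA (glue (a tt) b)).
by move: (Hb tt) (Hc tt); rewrite /pair_family !ffunE E.
Qed.

Lemma NIP_in_ord (L : language) (T : h_theory L) (m : nat) :
  NIP_in T 'I_1 -> NIP_in T 'I_m.
Proof.
move=> nip1; elim: m => [|m IH]; first exact: NIP_in_empty.
exact: (NIP_in_retract (@splitK 1 m) (NIP_in_sum nip1 IH)).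
Qed.

Theorem proposition6p29 (L : language) (T : h_theory L)
    (hT : consistent T) (hJCP : joint_continuation T)
    (h1 : forall (n : nat) (phi : pform L (n + 1)), is_NIP T phi) :
  theory_NIP T.
Proof.
move=> n m phi [psi [inc [A [mA [a [b Hab]]]]]].
pose R (chi : pform L (n + m)) : relation L ('I_n + 'I_m) := fun A w =>
  sat chi [tuple w (split i) | i < n + m].
have posR chi : positive (R chi) by exists (n + m), (@split n m), chi.
have RE (B : structure L) chi (c : n.-tuple B) d :
    R chi B (glue (tnth c) (tnth d)) <-> psat chi c d by rewrite /R tuple_glue.
apply: (NIP_in_ord (NIP_in_one h1) (posR phi) (posR psi)).
  move=> B mB w; have := inc B mB [tuple w (inl i) | i < n] [tuple w (inr i) | i < m].
  rewrite -!RE; suff -> : glue (tnth [tuple w (inl i) | i < n])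
    (tnth [tuple w (inr i) | i < m]) = w by [].
  by apply: funext => -[i|i] /=; rewrite tnth_mktuple.
move=> I; exists A; split=> //; exists (fun i => tnth (a (enum_rank i))) => g.
pose W k := exists2 i, k = enum_rank i :> nat & g i.
exists (tnth (b W)) => i; have [HP HN] := Hab W (enum_rank i).
rewrite /pair_family; case E: (g i); rewrite RE; first by apply: HP; exists i.
by apply: HN => -[j /val_inj /enum_rank_inj <-]; rewrite E.
Qed.
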